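(* Let $\mathcal C$ be a small category, let $\mathcal O$ be an orbit family for $\mathcal C$ and let $\mathbb X$ be an $\mathcal O$-path-connected $\mathcal C$-space. Then \[ \mathrm{TC}_{\mathcal C}(\mathbb X)\leq\mathrm{cat}_{\mathcal C}^{\mathcal O}(\mathbb X\times\mathbb X). \]
   Context: All categories are small. $\mathrm{Top}$ is the category of compactly generated topological spaces; products, subspaces and mapping spaces are taken in compactly generated spaces (mapping spaces with the compactly generated compact-open topology). A $\mathcal C$-space is a functor $\mathbb X\colon\mathcal C\to\mathrm{Top}$; a $\mathcal C$-map is a natural transformation. Products are objectwise; a space $K$ is also regarded as a constant $\mathcal C$-space; $\mathbb I=[0,1]$. A $\mathcal C$-homotopy from $f$ to $g$ (with $f,g\colon\mathbb X\to\mathbb Y$) is a $\mathcal C$-map $H\colon\mathbb X\times\mathbb I\to\mathbb Y$ with $H_0=f$, $H_1=g$; then write $f\simeq_{\mathcal C}g$. The mapping space $\mathrm{Hom}_{\mathcal C}(\mathbb X,\mathbb Y)$ is the set of $\mathcal C$-maps topologized as a subspace of $\prod_{c}\mathrm{Hom}_{\mathrm{Top}}(\mathbb X(c),\mathbb Y(c))$. A topological $\mathcal C$-orbit is a $\mathcal C$-space $\mathbb T$ with $\varinjlim_{\mathcal C}\mathbb T\cong *$ (colimit in $\mathrm{Top}$). An orbit family for $\mathcal C$ is a class $\mathcal O$ of topological $\mathcal C$-orbits, closed under isomorphism and containing every representable $\mathcal C(c,-)$, regarded as an objectwise discrete $\mathcal C$-space. $\mathbb X$ is $\mathcal O$-path-connected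 if for every $\mathbb T\in\mathcal O$ any two points of $\mathrm{Hom}_{\mathcal C}(\mathbb T,\mathbb X)$ can be joined by a path (vacuous if this space is empty). An open $\mathcal C$-subspace $\mathbb U\subseteq\mathbb Y$ is a family of open subspaces $\mathbb U(c)\subseteq\mathbb Y(c)$ stable under the structure maps (with restricted structure maps); $\iota_{\mathbb U}\colon\mathbb U\hookrightarrow\mathbb Y$ is the inclusion. An open cover of $\mathbb Y$ is a collection $\{\mathbb U_i\}$ of open $\mathcal C$-subspaces with $\mathbb Y(c)=\bigcup_i\mathbb U_i(c)$ for every object $c$. $\mathbb U$ is $\mathcal O$-categorical in $\mathbb Y$ if there are $\mathbb T\in\mathcal O$ and $\mathcal C$-maps $a\colon\mathbb U\to\mathbb T$, $O\colon\mathbb T\to\mathbb Y$ with $\iota_{\mathbb U}\simeq_{\mathcal C}O\circ a$. $\mathrm{cat}_{\mathcal C}^{\mathcal O}(\mathbb Y)$ is the least integer $n\ge0$ such that $\mathbb Y$ has an open cover $\{\mathbb U_0,\dots,\mathbb U_n\}$ by $\mathcal O$-categorical open $\mathcal C$-subspaces ($\infty$ if none exists). For a $\mathcal C$-map $p\colon\mathbb E\to\mathbb B$, an open $\mathcal C$-subspace $\mathbb U\subseteq\mathbb B$ is sectional for $p$ if there is a $\mathcal C$-map $s\colon\mathbb U\to\mathbb E$ with $p\circ s\simeq_{\mathcal C}\iota_{\mathbb U}$. $\mathrm{sec}_{\mathcal C}(p)$ is the least integer $n\ge0$ such that $\mathbb B$ has an open cover by $n+1$ sectional open $\mathcal C$-subspaces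 $\mathbb U_0,\dots,\mathbb U_n$ ($\infty$ if none exists). The path $\mathcal C$-space $\mathbb X^{\mathbb I}$ is given by $\mathbb X^{\mathbb I}(c)=\mathrm{Hom}_{\mathrm{Top}}(\mathbb I,\mathbb X(c))$, $\mathbb X^{\mathbb I}(\alpha)(\gamma)=\mathbb X(\alpha)\circ\gamma$; the endpoint evaluation $\pi_{\mathbb X}\colon\mathbb X^{\mathbb I}\to\mathbb X\times\mathbb X$ is $\pi_{\mathbb X,c}(\gamma)=(\gamma(0),\gamma(1))$; and $\mathrm{TC}_{\mathcal C}(\mathbb X)=\mathrm{sec}_{\mathcal C}(\pi_{\mathbb X})$. *)

(* Defs.v *)
From HB Require Import structures.
From mathcomp Require Import all_boot all_order all_algebra.
From mathcomp Require Import all_classical all_reals all_analysis.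
From mathcomp Require Import continuous_path.

Set Implicit Arguments.
Unset Strict Implicit.
Unset Printing Implicit Defensive.

Import Order.TTheory GRing.Theory Num.Theory.
Import numFieldNormedType.Exports.

Local Open Scope classical_set_scope.

(* "Compactly generated" is read as "k-space" in the sense of test maps from
   compact Hausdorff spaces; no (weak) Hausdorff condition is part of it. *)
Definition k_open (X : topologicalType) (A : set X) : Prop :=
  forall (K : topologicalType) (u : continuousType K X),
    compact [set: K] -> hausdorff_space K -> open (u @^-1` A).

HB.mixin Record isCompactlyGenerated X & Topological X := {
  k_open_open : forall A : set X, k_open A -> open A
}.

#[short(type="cgType")]
HB.structure Definition CompactlyGenerated :=
  {X of isCompactlyGenerated X & Topological X}.

Definition kification (X : Type) : Type := X.

Section Kification.
Variable X : topologicalType.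

Local Lemma k_openT : k_open [set: X].
Proof. by move=> K u _ _; rewrite preimage_setT; exact: openT. Qed.

Local Lemma k_openI : setI_closed (@k_open X).
Proof.
move=> A B kA kB K u cK hK; rewrite preimage_setI.
by apply: openI; [exact: kA|exact: kB].
Qed.

Local Lemma k_open_bigU (I : Type) (f : I -> set X) :
  (forall i, k_open (f i)) -> k_open (\bigcup_i f i).
Proof.
move=> kf K u cK hK; rewrite preimage_bigcup.
by apply: bigcup_open => i _; exact: kf.
Qed.

HB.instance Definition _ := Choice.copy (kification X) X.
HB.instance Definition _ :=
  isOpenTopological.Build (kification X) k_openT k_openI k_open_bigU.

Lemma kification_openE : @open (kification X) = @k_open X.
Proof. by []. Qed.

Lemma open_kification (A : set X) : open A -> open (A : set (kification X)).
Proof.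
move=> oA; rewrite kification_openE => K u _ _.
apply: open_comp => // x _; exact: (@cts_fun _ _ u).
Qed.

Lemma test_map_kification (K : topologicalType) (u : K -> X) :
  compact [set: K] -> hausdorff_space K -> continuous u ->
  continuous (u : K -> kification X).
Proof.
move=> cK hK cu; apply/continuousP => A; rewrite kification_openE => kA.
exact: (kA K (mkcts cu)).
Qed.

Local Lemma kification_cg (A : set (kification X)) : k_open A -> open A.
Proof.
move=> kA; rewrite kification_openE => K u cK hK.
exact: (kA K (mkcts (test_map_kification cK hK (@cts_fun _ _ u)))).
Qed.

HB.instance Definition _ :=
  isCompactlyGenerated.Build (kification X) kification_cg.

Lemma from_kification_continuous (Y : topologicalType) (f : X -> Y) :
  continuous f -> continuous (f : kification X -> Y).
Proof.
move=> /continuousP cf; apply/continuousP => A oA.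
by apply: open_kification; exact: cf.
Qed.

Lemma to_kification_continuous (Z : cgType) (f : Z -> X) :
  continuous f -> continuous (f : Z -> kification X).
Proof.
move=> cf; apply/continuousP => A; rewrite kification_openE => kA.
apply: k_open_open => K u cK hK.
have cfu : continuous (f \o u).
  by move=> z; apply: continuous_comp; [exact: cts_fun|exact: cf].
exact: (kA K (mkcts cfu)).
Qed.

End Kification.

Lemma kification_map_continuous (X Y : topologicalType) (f : X -> Y) :
  continuous f -> continuous (f : kification X -> kification Y).
Proof.
move=> cf; apply: to_kification_continuous.
exact: from_kification_continuous.
Qed.

Lemma compact_hausdorff_cg (X : topologicalType) :
  compact [set: X] -> hausdorff_space X ->
  forall A : set X, k_open A -> open A.
Proof. by move=> cX hX A /(_ X idfun cX hX). Qed.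

HB.instance Definition _ (T : choiceType) :=
  isCompactlyGenerated.Build (discrete_topology T)
    (fun A _ => @discrete_open (discrete_topology T) A).

Definition one_point : cgType := discrete_topology unit.

Definition cg_prod (X Y : cgType) : cgType := kification (X * Y)%type.

Definition cg_big_prod (I : Type) (X : I -> cgType) : cgType :=
  kification (prod_topology X).

Definition cg_sub (X : cgType) (A : set X) : cgType := kification (set_type A).

(* The subbasic sets of the compact-open topology on continuous maps are
   indexed by test maps and not by compact subsets of X; this is the form that
   makes the category cartesian closed when X need not be Hausdorff. *)
Section MappingSpace.
Variables X Y : topologicalType.

Definition compact_open_subbase : set (set (continuousType X Y)) :=
  [set W | exists (K : topologicalType) (u : continuousType K X) (V : set Y),
    [/\ compact [set: K], hausdorff_space K, open V &
        W = [set f : continuousType X Y | forall k, V (f (u k))]]].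

Definition mapping_topology : Type := continuousType X Y.

HB.instance Definition _ := Choice.on mapping_topology.
HB.instance Definition _ :=
  isSubBaseTopological.Build mapping_topology compact_open_subbase id.

Lemma open_compact_open (W : set (continuousType X Y)) :
  compact_open_subbase W -> open (W : set mapping_topology).
Proof.
move=> sW; exists [set W]; last by rewrite bigcup_set1.
by move=> _ ->; exact: (@finI_from1 _ _ compact_open_subbase id).
Qed.

Lemma to_compact_open_continuous (Z : topologicalType)
  (h : Z -> continuousType X Y) :
  (forall W, compact_open_subbase W -> open (h @^-1` W)) ->
  continuous (h : Z -> mapping_topology).
Proof.
move=> hW; apply/continuousP => A [D sD <-]; rewrite preimage_bigcup.
apply: bigcup_open => B /sD [E sE <-]; rewrite openE => z /= hz.
apply: filter_bigI => W EW; apply: open_nbhs_nbhs; split; last exact: hz.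
by apply: hW; rewrite -in_setE; exact: sE.
Qed.

End MappingSpace.

Definition mapping_space (X Y : cgType) : cgType :=
  kification (mapping_topology X Y).

Record category := Category {
  ob :> Type;
  hom : ob -> ob -> Type;
  idm : forall c, hom c c;
  compm : forall c d e, hom d e -> hom c d -> hom c e;
  compm1 : forall c d (f : hom c d), compm f (idm c) = f;
  comp1m : forall c d (f : hom c d), compm (idm d) f = f;
  compmA : forall a b c d (h : hom c d) (g : hom b c) (f : hom a b),
    compm h (compm g f) = compm (compm h g) f
}.

Record cspace (C : category) := CSpace {
  space :> C -> cgType;
  act : forall c d : C, hom c d -> continuousType (space c) (space d);
  act_id : forall c (x : space c), act (idm c) x = x;
  act_comp : forall c d e (g : hom d e) (f : hom c d) (x : space c),
    act (compm g f) x = act g (act f x)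
}.
Arguments act {C} X {c d} f : rename.

Record cmap (C : category) (X Y : cspace C) := CMap {
  component :> forall c : C, continuousType (X c) (Y c);
  cmap_natural : forall (c d : C) (f : hom c d) (x : X c),
    component d (act X f x) = act Y f (component c x)
}.

HB.instance Definition _ (C : category) (X Y : cspace C) :=
  gen_eqMixin (cmap X Y).
HB.instance Definition _ (C : category) (X Y : cspace C) :=
  gen_choiceMixin (cmap X Y).

Section CMaps.
Variable C : category.
Implicit Types X Y Z : cspace C.

Local Lemma cmap_comp_natural X Y Z (g : cmap Y Z) (f : cmap X Y)
  (c d : C) (h : hom c d) (x : X c) :
  (g d \o f d) (act X h x) = act Z h ((g c \o f c) x).
Proof. by rewrite /= !cmap_natural. Qed.

Definition cmap_comp X Y Z (g : cmap Y Z) (f : cmap X Y) : cmap X Z :=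
  @CMap C X Z (fun c => g c \o f c) (@cmap_comp_natural X Y Z g f).

Definition cspace_iso X Y : Prop :=
  exists (f : cmap X Y) (g : cmap Y X),
    (forall c, cancel (f c) (g c)) /\ (forall c, cancel (g c) (f c)).

Definition cmap_family X Y (f : cmap X Y) :
  cg_big_prod (fun c => mapping_space (X c) (Y c)) := component f.

Definition hom_space X Y : cgType :=
  kification (initial_topology (@cmap_family X Y)).

Section Product.
Variables X Y : cspace C.

Local Lemma prod_act_continuous (c d : C) (f : hom c d) :
  continuous ((fun p => (act X f p.1, act Y f p.2))
    : cg_prod (X c) (Y c) -> cg_prod (X d) (Y d)).
Proof.
apply: (@kification_map_continuous (X c * Y c)%type (X d * Y d)%type) => p.
apply: cvg_pair => /=.
  apply: (@continuous_comp _ _ _ fst (act X f)); first exact: cvg_fst.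
  exact: cts_fun.
apply: (@continuous_comp _ _ _ snd (act Y f)); first exact: cvg_snd.
exact: cts_fun.
Qed.

Definition cs_prod : cspace C.
Proof.
refine (@CSpace C (fun c => cg_prod (X c) (Y c))
  (fun c d f => mkcts (@prod_act_continuous c d f)) _ _).
- by move=> c [x y]; exact: (f_equal2 pair (act_id x) (act_id y)).
- move=> c d e g f [x y].
  exact: (f_equal2 pair (act_comp g f x) (act_comp g f y)).
Defined.

End Product.

Definition cs_const (K : cgType) : cspace C :=
  @CSpace C (fun=> K) (fun _ _ _ => idfun) (fun _ _ => erefl)
    (fun _ _ _ _ _ _ => erefl).

Section Representable.
Variable c : C.

Local Lemma from_discrete_continuous (S : choiceType) (Y : topologicalType)
  (f : S -> Y) : continuous (f : discrete_topology S -> Y).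
Proof. by apply/continuousP => A _; exact: discrete_open. Qed.

(* {classic T} is T with the choice structure required of every space. *)
Definition representable : cspace C.
Proof.
refine (@CSpace C (fun d => discrete_topology {classic (hom c d)})
  (fun d e f => mkcts (@from_discrete_continuous {classic (hom c d)}
     (discrete_topology {classic (hom c e)}) (fun g => compm f g))) _ _).
- by move=> d g; exact: comp1m.
- by move=> d e e' g f h; exact: esym (compmA g f h).
Defined.

End Representable.

Record cocone (X : cspace C) (L : cgType) := Cocone {
  leg :> forall c : C, continuousType (X c) L;
  leg_act : forall (c d : C) (f : hom c d) (x : X c),
    leg d (act X f x) = leg c x
}.

Definition is_colimit (X : cspace C) (L : cgType) (l : cocone X L) : Prop :=
  forall (Z : cgType) (m : cocone X Z),
    exists! h : continuousType L Z, forall c (x : X c), h (l c x) = m c x.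

Definition homeomorphic (X Y : cgType) : Prop :=
  exists (f : continuousType X Y) (g : continuousType Y X),
    cancel f g /\ cancel g f.

Definition is_orbit (T : cspace C) : Prop :=
  exists (L : cgType) (l : cocone T L),
    is_colimit l /\ homeomorphic L one_point.

Record orbit_family (O : cspace C -> Prop) : Prop := OrbitFamily {
  orbit_family_orbit : forall T, O T -> is_orbit T;
  orbit_family_iso : forall T T', cspace_iso T T' -> O T -> O T';
  orbit_family_representable : forall c : C, O (representable c)
}.

Record open_cs (Y : cspace C) := OpenCS {
  carrier :> forall c : C, set (Y c);
  carrier_open : forall c, open (@carrier c);
  carrier_act : forall (c d : C) (f : hom c d) (y : Y c),
    @carrier c y -> @carrier d (act Y f y)
}.
Arguments carrier {Y} U c _ : rename.

Section OpenSubspace.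
Variables (Y : cspace C) (U : open_cs Y).

Definition sub_act (c d : C) (f : hom c d) (y : cg_sub (U c)) : cg_sub (U d) :=
  exist _ (act Y f (\val y)) (mem_set (carrier_act f (set_mem (valP y)))).

Local Lemma sub_act_continuous (c d : C) (f : hom c d) :
  continuous (@sub_act c d f).
Proof.
apply: (@kification_map_continuous (set_type (U c)) (set_type (U d))).
apply: continuous_comp_initial => x.
apply: (@continuous_comp _ _ _ set_val (act Y f)); last exact: cts_fun.
exact: initial_continuous.
Qed.

Definition sub_cs : cspace C.
Proof.
refine (@CSpace C (fun c => cg_sub (U c))
  (fun c d f => mkcts (@sub_act_continuous c d f)) _ _).
- by move=> c x; apply: val_inj; exact: act_id.
- by move=> c d e g f x; apply: val_inj; exact: act_comp.
Defined.

Local Lemma sub_incl_continuous (c : C) :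
  continuous (\val : cg_sub (U c) -> Y c).
Proof.
apply: (@from_kification_continuous (set_type (U c))).
exact: initial_continuous.
Qed.

Definition sub_incl : cmap sub_cs Y :=
  @CMap C sub_cs Y (fun c => mkcts (@sub_incl_continuous c))
    (fun _ _ _ _ => erefl).

End OpenSubspace.

Definition covers (Y : cspace C) (I : Type) (U : I -> open_cs Y) : Prop :=
  forall c, \bigcup_i U i c = [set: Y c].

End CMaps.

Section UnitInterval.
Variable R : realType.
Local Open Scope ring_scope.

Definition unit_interval : Type := set_type `[0 : R, 1]%classic.

HB.instance Definition _ :=
  Topological.copy unit_interval (set_type `[0 : R, 1]%classic).

Local Lemma unit_interval_compact : compact [set: unit_interval].
Proof.
move=> F FF _; have [] := @segment_compact R 0 1 (set_val @ F) _.
- apply: (@filterS _ F _ setT _ _ filterT) => x _.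
  exact: set_mem (valP x).
- move=> p [p01 clp]; exists (exist _ p (mem_set p01)); split => // A B FA.
  move=> [_ [[V oV <-] Vp VB]].
  have FvA : (set_val @ F) (set_val @` A).
    by apply: (@filterS _ F _ A _ _ FA) => x Ax; exists x.
  have [_ [[x Ax <-] Vx]] := clp _ _ FvA (open_nbhs_nbhs (conj oV Vp)).
  by exists x; split => //; exact: VB.
Qed.

Local Lemma unit_interval_hausdorff : hausdorff_space unit_interval.
Proof.
move=> x y cl; apply: val_inj; apply: (@Rhausdorff R) => A B Ax By.
have cv := @initial_continuous unit_interval R set_val.
by have [z [Az Bz]] := cl _ _ (cv x _ Ax) (cv y _ By); exists (set_val z).
Qed.

HB.instance Definition _ :=
  isCompactlyGenerated.Build unit_interval
    (compact_hausdorff_cg unit_interval_compact unit_interval_hausdorff).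

Local Lemma unit_interval0 : (0 : R) \in `[0, 1]%classic.
Proof. by rewrite inE /= in_itv /= lexx ler01. Qed.

Local Lemma unit_interval1 : (1 : R) \in `[0, 1]%classic.
Proof. by rewrite inE /= in_itv /= lexx ler01. Qed.

Local Lemma unit_interval01 :
  (exist _ 0 unit_interval0 : unit_interval) != exist _ 1 unit_interval1.
Proof. by rewrite -val_eqE /= eq_sym oner_neq0. Qed.

HB.instance Definition _ :=
  isBiPointed.Build unit_interval unit_interval01.

End UnitInterval.

Definition least_or_infty (P : nat -> Prop) : \bar int :=
  match pselect (exists n, `[< P n >]) with
  | left exP => ((ex_minn exP)%:Z)%:E
  | right _ => +oo%E
  end.

Section Invariants.
Variables (R : realType) (C : category).
Local Notation I := (unit_interval R).
Implicit Types X Y : cspace C.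

Definition homotopic X Y (f g : cmap X Y) : Prop :=
  exists H : cmap (cs_prod X (cs_const C I)) Y,
    forall c (x : X c), H c (x, zero) = f c x /\ H c (x, one) = g c x.

Definition path_connected_wrt (O : cspace C -> Prop) X : Prop :=
  forall T, O T -> forall f g : hom_space T X, inhabited {path I from f to g}.

Definition categorical (O : cspace C -> Prop) Y (U : open_cs Y) : Prop :=
  exists T, O T /\ exists (a : cmap (sub_cs U) T) (o : cmap T Y),
    homotopic (sub_incl U) (cmap_comp o a).

Definition orbit_cat (O : cspace C -> Prop) Y : \bar int :=
  least_or_infty (fun n => exists U : 'I_n.+1 -> open_cs Y,
    covers U /\ forall i, categorical O (U i)).

Definition sectional E B (p : cmap E B) (U : open_cs B) : Prop :=
  exists s : cmap (sub_cs U) E, homotopic (cmap_comp p s) (sub_incl U).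

Definition sec E B (p : cmap E B) : \bar int :=
  least_or_infty (fun n => exists U : 'I_n.+1 -> open_cs B,
    covers U /\ forall i, sectional p (U i)).

Section PathSpace.
Variable X : cspace C.

Local Lemma postcomp_continuous (A Y Z : cgType) (g : continuousType Y Z) :
  continuous ((fun f => g \o f : continuousType A Z)
    : mapping_space A Y -> mapping_space A Z).
Proof.
apply: (@kification_map_continuous (mapping_topology A Y)
          (mapping_topology A Z)).
apply: to_compact_open_continuous => _ [K [u [V [cK hK oV ->]]]].
apply: open_compact_open; exists K, u, (g @^-1` V); split => //.
by apply: open_comp => // y _; exact: cts_fun.
Qed.

Local Lemma eval_continuous_at (A Y : cgType) (a : A) :
  continuous ((fun f => f a) : mapping_space A Y -> Y).
Proof.
apply: (@from_kification_continuous (mapping_topology A Y)).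
apply/continuousP => V oV; apply: open_compact_open.
exists one_point, (cst a : continuousType one_point A), V; split => //.
- have -> : [set: one_point] = [set tt] by rewrite predeqE => -[].
  exact: compact_set1.
- exact: discrete_hausdorff.
- by rewrite predeqE => f; split => [fV _ //|/(_ tt)].
Qed.

Definition path_cs : cspace C.
Proof.
refine (@CSpace C (fun c => mapping_space I (X c))
  (fun c d f => mkcts (@postcomp_continuous I (X c) (X d) (act X f))) _ _).
- by move=> c x; apply/continuousEP => t; exact: act_id.
- by move=> c d e g f x; apply/continuousEP => t; exact: act_comp.
Defined.

Definition endpoints (c : C) (g : path_cs c) : cs_prod X X c := (g zero, g one).

Local Lemma endpoints_continuous (c : C) : continuous (@endpoints c).
Proof.
apply: (@to_kification_continuous (X c * X c)%type) => g.
apply: cvg_pair; first exact: (@nbhs_filter (path_cs c) g).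
  exact: (@eval_continuous_at I (X c) zero g).
exact: (@eval_continuous_at I (X c) one g).
Qed.

Definition path_eval : cmap path_cs (cs_prod X X) :=
  @CMap C path_cs (cs_prod X X) (fun c => mkcts (@endpoints_continuous c))
    (fun _ _ _ _ => erefl).

Definition TC : \bar int := sec path_eval.

End PathSpace.
End Invariants.

(* Main.v *)
Require Import Defs.
From mathcomp Require Import all_boot all_order all_algebra.
From mathcomp Require Import all_classical all_reals all_analysis.
From mathcomp Require Import continuous_path.

(** Let U be an open subspace of X x X whose inclusion is homotopic to a
composite U -> T -> X x X through an orbit T of the family.  The two
coordinates of T -> X x X are points of the mapping space Hom(T, X), and
path-connectedness joins them by a path p in that space.  Exchanging the time
variable with the variable of T turns p into a map from T to the path space
of X whose endpoint evaluation is the given map T -> X x X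
([path_of_hom_path], [path_of_hom_pathE]).  Precomposed with U -> T it is a
map s from U to the path space such that the endpoint evaluation of s is
U -> T -> X x X, hence homotopic to the inclusion of U.  So every categorical
open subspace is sectional ([categorical_sectional]), the same covers serve
both invariants, and the inequality follows.

The analytic content is the exchange of variables: a continuous map
h : A -> Map(T, Y) between compactly generated spaces has a continuous
transpose T -> Map(A, Y) ([swap_continuous]).  T need not be locally compact,
so evaluation Map(T, Y) x T -> Y need not be jointly continuous for the
compact-open topology.  It becomes so after restriction along a test map
L -> T from a compact Hausdorff space ([near_eval_test_map]), and as T is
compactly generated this suffices to test openness in T; compactness of the
test spaces of A then gives the uniformity required by the compact-open
topology of Map(A, Y). *)

Set Implicit Arguments.
Unset Strict Implicit.
Unset Printing Implicit Defensive.

Import Order.TTheory GRing.Theory Num.Theory.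
Import numFieldNormedType.Exports.

Local Open Scope classical_set_scope.

(** * Exchange of variables in mapping spaces *)

Lemma compact_set_type (X : topologicalType) (A : set X) :
  compact A -> compact [set: set_type A].
Proof.
move=> cA F FF _; have [] := cA (set_val @ F) _.
  apply: (@filterS _ F _ setT _ _ filterT) => x _; exact: set_mem (valP x).
move=> p [Ap clp]; exists (exist _ p (mem_set Ap)); split => // B D FB.
move=> [_ [[V oV <-] Vp VD]].
have FvB : (set_val @ F) (set_val @` B).
  by apply: (@filterS _ F _ B _ _ FB) => x Bx; exists x.
have [_ [[x Bx <-] Vx]] := clp _ _ FvB (open_nbhs_nbhs (conj oV Vp)).
by exists x; split => //; exact: VD.
Qed.

Lemma hausdorff_set_type (X : topologicalType) (A : set X) :
  hausdorff_space X -> hausdorff_space (set_type A).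
Proof.
move=> hX x y cl; apply: val_inj; apply: hX => B D Bx Dy.
have cv := @initial_continuous (set_type A) X set_val.
by have [z [Bz Dz]] := cl _ _ (cv x _ Bx) (cv y _ Dy); exists (set_val z).
Qed.

(** Joint continuity of evaluation along a test map [v].  As [L] is regular,
[l0] has a closed neighbourhood that [f0 \o v] sends into [V]; that
neighbourhood is itself compact Hausdorff, so the maps sending it into [V]
form a subbasic open set. *)
Lemma near_eval_test_map (X Y L : topologicalType) (v : continuousType L X)
    (f0 : mapping_topology X Y) (l0 : L) (V : set Y) :
  compact [set: L] -> hausdorff_space L -> open V ->
  V ((f0 : continuousType X Y) (v l0)) ->
  \forall f \near f0 & l \near l0, V ((f : continuousType X Y) (v l)).
Proof.
move=> cL hL oV Vfl.
have nV : nbhs l0 ((fun l => (f0 : continuousType X Y) (v l)) @^-1` V).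
  apply: (continuous_comp (@cts_fun _ _ v l0)
    (@cts_fun _ _ (f0 : continuousType X Y) (v l0))).
  exact: open_nbhs_nbhs.
have [N nN clN] := compact_regular hL cL (@filterT _ _ (nbhs_filter l0)) nV.
have cN : compact (closure N).
  exact: subclosed_compact (@closed_closure _ N) cL (@subsetT _ _).
have cw : continuous (v \o set_val : set_type (closure N) -> X).
  move=> x; apply: continuous_comp; last exact: cts_fun.
  exact: initial_continuous.
pose W := [set f : continuousType X Y | forall k, V (f (mkcts cw k))].
have nf0 : nbhs f0 (W : set (mapping_topology X Y)).
  apply: open_nbhs_nbhs; split.
    apply: open_compact_open; exists (set_type (closure N)), (mkcts cw), V.
    by split => //; [exact: compact_set_type|exact: hausdorff_set_type].
  move=> k; exact: clN (set_mem (valP k)).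
exists (W, N) => //= -[f l] /= [Wf Nl].
exact: (Wf (exist _ l (mem_set (subset_closure Nl)))).
Qed.

Lemma eval_at_continuous (A T Y : cgType)
    (h : continuousType A (mapping_space T Y)) (t : T) :
  continuous ((fun a => (h a : continuousType T Y) t) : A -> Y).
Proof.
move=> a; apply: (@continuous_comp _ _ _ h
  ((fun f => f t) : mapping_space T Y -> Y)); first exact: cts_fun.
exact: Defs.eval_continuous_at.
Qed.

Definition swap_fun (A T Y : cgType)
    (h : continuousType A (mapping_space T Y)) (t : T) : mapping_space A Y :=
  mkcts (@eval_at_continuous A T Y h t).

(** The preimage of a subbasic set, given by a test map [u : K -> A] and an
open [V], is the set of [t] with [h (u k) t] in [V] for all [k].  It is open
along each test map [v : L -> T] by the tube lemma for [K], because
[(k, l) |-> h (u k) (v l)] is jointly continuous. *)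
Lemma swap_continuous (A T Y : cgType)
    (h : continuousType A (mapping_space T Y)) :
  continuous (swap_fun h).
Proof.
apply: (@to_kification_continuous (mapping_topology A Y) T).
apply: to_compact_open_continuous => _ [K [u [V [cK hK oV ->]]]].
apply: k_open_open => L v cL hL; rewrite openE => l0 /= hl0.
suff : \forall l \near l0, [set: K] `<=`
    fun k => V ((h (u k) : continuousType T Y) (v l)).
  by apply: filterS => l hl k; exact: hl.
have ch : continuous (fun a => h a : mapping_topology T Y).
  move=> a; apply: (@continuous_comp _ _ _ h
    (id : mapping_space T Y -> mapping_topology T Y)); first exact: cts_fun.
  apply: (@from_kification_continuous (mapping_topology T Y)
            (mapping_topology T Y) id) => f; exact: cvg_id.
have chu : continuous (fun k => h (u k) : mapping_topology T Y).
  by move=> x; apply: continuous_comp; [exact: cts_fun|exact: ch].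
move/compact_near_coveringP : cK; apply => k _.
have [[P Q] /= [nP nQ] PQ] := near_eval_test_map cL hL oV (hl0 k).
exists (((fun k => h (u k) : mapping_topology T Y) @^-1` P), Q) => /=.
  by split => //; exact: chu.
by move=> [k' l] /= [Pk Ql]; exact: (PQ (_, _)).
Qed.

(** * Paths of maps and maps to the path space *)

Lemma hom_space_component_continuous (C : category) (X Y : cspace C) (c : C) :
  continuous ((fun f : hom_space X Y => (f : cmap X Y) c)
    : hom_space X Y -> mapping_space (X c) (Y c)).
Proof.
apply: (@from_kification_continuous (initial_topology (@cmap_family C X Y))).
move=> f.
apply: (@continuous_comp _ _ _ (@cmap_family C X Y : initial_topology _ -> _)
  (fun g : cg_big_prod (fun c => mapping_space (X c) (Y c)) => g c)).
  exact: initial_continuous.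
apply: (@from_kification_continuous (prod_topology _)).
(* Isolating one coordinate of a family compares indices, so the objects of C
   are given their classical decidable equality. *)
exact: (@proj_continuous {classic (ob C)}
  (fun d : {classic (ob C)} => mapping_space (X d) (Y d)) c).
Qed.

Lemma hom_path_component_continuous (R : realType) (C : category)
    (T X : cspace C) (f g : hom_space T X)
    (p : {path (unit_interval R) from f to g}) (c : C) :
  continuous ((fun s => (p s : cmap T X) c)
    : unit_interval R -> mapping_space (T c) (X c)).
Proof.
move=> s; apply: (@continuous_comp _ _ _ p
  ((fun h => (h : cmap T X) c) : hom_space T X -> mapping_space (T c) (X c))).
  exact: cts_fun.
exact: hom_space_component_continuous.
Qed.

Definition path_of_hom_path (R : realType) (C : category) (T X : cspace C)
    (f g : hom_space T X) (p : {path (unit_interval R) from f to g}) :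
  cmap T (path_cs R X).
Proof.
refine (@CMap C T (path_cs R X)
  (fun c => mkcts (@swap_continuous (unit_interval R) (T c) (X c)
     (mkcts (@hom_path_component_continuous R C T X f g p c)))) _).
by move=> c d a x; apply/continuousEP => s; exact: cmap_natural.
Defined.

Lemma path_of_hom_pathE (R : realType) (C : category) (T X : cspace C)
    (f g : hom_space T X) (p : {path (unit_interval R) from f to g})
    (c : C) (x : T c) :
  path_eval R X c (path_of_hom_path p c x) =
  ((f : cmap T X) c x, (g : cmap T X) c x).
Proof.
transitivity ((p zero : cmap T X) c x, (p one : cmap T X) c x); first by [].
by rewrite (@path_zero _ _ _ _ p) (@path_one _ _ _ _ p).
Qed.

(** * Coordinates of a map into a product *)

Lemma cg_fst_continuous (A B : cgType) : continuous (fst : cg_prod A B -> A).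
Proof.
by apply: (@from_kification_continuous (A * B)%type A fst) => x; exact: cvg_fst.
Qed.

Lemma cg_snd_continuous (A B : cgType) : continuous (snd : cg_prod A B -> B).
Proof.
by apply: (@from_kification_continuous (A * B)%type B snd) => x; exact: cvg_snd.
Qed.

Definition cs_fst (C : category) (X Y : cspace C) : cmap (cs_prod X Y) X :=
  @CMap C (cs_prod X Y) X (fun c => mkcts (@cg_fst_continuous (X c) (Y c)))
    (fun _ _ _ _ => erefl).

Definition cs_snd (C : category) (X Y : cspace C) : cmap (cs_prod X Y) Y :=
  @CMap C (cs_prod X Y) Y (fun c => mkcts (@cg_snd_continuous (X c) (Y c)))
    (fun _ _ _ _ => erefl).

(** * Reversal of homotopies *)

Lemma interval_rev_subproof (R : realType) (s : unit_interval R) :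
  (1 - val s)%R \in `[0%R : R, 1%R]%classic.
Proof.
case: s => s /=; rewrite !inE /= !in_itv /= => /andP[s0 s1].
by rewrite subr_ge0 s1 lerBlDr lerDl.
Qed.

Definition interval_rev (R : realType) (s : unit_interval R) :
  unit_interval R := exist _ (1 - val s)%R (interval_rev_subproof s).

Lemma interval_rev_continuous (R : realType) : continuous (@interval_rev R).
Proof.
apply: continuous_comp_initial => s.
apply: continuousB; first exact: cst_continuous.
exact: initial_continuous.
Qed.

Lemma interval_rev0 (R : realType) : @interval_rev R zero = one.
Proof. by apply: val_inj; rewrite /= subr0. Qed.

Lemma interval_rev1 (R : realType) : @interval_rev R one = zero.
Proof. by apply: val_inj; rewrite /= subrr. Qed.

Lemma cg_prod_map_snd_continuous (A B D : cgType) (g : B -> D) :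
  continuous g ->
  continuous ((fun p => (p.1, g p.2)) : cg_prod A B -> cg_prod A D).
Proof.
move=> cg; apply: (@kification_map_continuous (A * B)%type (A * D)%type) => p.
apply: cvg_pair => /=; first exact: cvg_fst.
apply: (@continuous_comp _ _ _ snd g); first exact: cvg_snd.
exact: cg.
Qed.

Definition rev_time (R : realType) (C : category) (X : cspace C) :
  cmap (cs_prod X (cs_const C (unit_interval R)))
       (cs_prod X (cs_const C (unit_interval R))) :=
  @CMap C (cs_prod X (cs_const C (unit_interval R)))
    (cs_prod X (cs_const C (unit_interval R)))
    (fun c => mkcts (@cg_prod_map_snd_continuous (X c) (unit_interval R)
       (unit_interval R) _ (@interval_rev_continuous R)))
    (fun _ _ _ _ => erefl).

Lemma homotopic_sym (R : realType) (C : category) (X Y : cspace C)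
    (f g : cmap X Y) :
  homotopic R f g -> homotopic R g f.
Proof.
move=> [H Hfg]; exists (cmap_comp H (rev_time R X)) => c x.
have [H0 H1] := Hfg c x; split.
  by transitivity (H c (x, interval_rev zero)); rewrite // interval_rev0.
by transitivity (H c (x, interval_rev one)); rewrite // interval_rev1.
Qed.

Lemma homotopic_eq (R : realType) (C : category) (X Y : cspace C)
    (f f' g : cmap X Y) :
  (forall c, f c =1 f' c) -> homotopic R f g -> homotopic R f' g.
Proof.
by move=> ff' [H Hfg]; exists H => c x; rewrite -ff'; exact: Hfg.
Qed.

(** * Comparison of the invariants *)

(** A path in Hom(T, X) between the coordinates of the map T -> X x X is a
lift of that map to the path space, so the factorization of the inclusion
through T lifts with it. *)
Lemma categorical_sectional (R : realType) (C : category)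
    (O : cspace C -> Prop) (X : cspace C) (U : open_cs (cs_prod X X)) :
  path_connected_wrt R O X -> categorical R O U ->
  sectional R (path_eval R X) U.
Proof.
move=> pcX [T [OT [a [orb hom_orb]]]].
have [p] := pcX T OT (cmap_comp (cs_fst X X) orb) (cmap_comp (cs_snd X X) orb).
exists (cmap_comp (path_of_hom_path p) a).
apply: homotopic_eq (homotopic_sym hom_orb) => c x.
transitivity (path_eval R X c (path_of_hom_path p c (a c x))); last by [].
by rewrite path_of_hom_pathE -surjective_pairing.
Qed.

Lemma least_or_infty_le (P Q : nat -> Prop) :
  (forall n, Q n -> P n) -> (least_or_infty P <= least_or_infty Q)%E.
Proof.
move=> QP; rewrite /least_or_infty.
case: (pselect (exists n, `[< Q n >])) => [exQ|nQ]; last by rewrite leey.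
case: pselect => [exP|[]]; last first.
  by case: exQ => n /asboolP /QP /asboolP ?; exists n.
rewrite lee_fin lez_nat; case: ex_minnP => m _ mP.
case: ex_minnP => n /asboolP Qn _.
by apply: mP; apply/asboolP; exact: QP.
Qed.

Theorem theorem5p8 (R : realType) (C : category) (O : cspace C -> Prop)
    (X : cspace C) :
  orbit_family O -> path_connected_wrt R O X ->
  (TC R X <= orbit_cat R O (cs_prod X X))%E.
Proof.
move=> _ pcX; apply: least_or_infty_le => n [U [cU catU]].
by exists U; split => // i; exact: categorical_sectional pcX (catU i).
Qed.
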